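(* For positive integers $m,n$, the sparing number of the square of the complete bipartite graph $K_{m,n}$ is $\varphi(K_{m,n}^2)=\frac{1}{2}(m+n-1)(m+n-2)$.
   Context: All graphs are simple and finite. $\mathbb{N}_0$ denotes the set of non-negative integers. For non-empty $A,B\subseteq\mathbb{N}_0$, $A+B=\{a+b: a\in A, b\in B\}$. An integer additive set-indexer (IASI) of a graph $G$ is an injective function $f:V(G)\to\mathcal{P}(\mathbb{N}_0)$ with non-empty values such that the induced map $f^+(uv)=f(u)+f(v)$ on $E(G)$ is also injective. An IASI is weak if $|f^+(uv)|=\max(|f(u)|,|f(v)|)$ for every edge $uv$. An element (vertex or edge) is mono-indexed if its set-label has cardinality $1$. The sparing number $\varphi(H)$ of a graph $H$ is the minimum number of mono-indexed edges over all weak IASIs of $H$. The square $G^2$ of $G$ has vertex set $V(G)$, two distinct vertices adjacent iff their distance in $G$ is at most $2$.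
   Formalization: Set-labels are required to be finite non-empty subsets of the non-negative integers; with infinite set-labels allowed, every vertex could get an infinite label and the sparing number would be 0, so the formula would fail for m+n ≥ 3. *)

(* Defs.v *)
From HB Require Import structures.
From mathcomp Require Import all_boot finmap.
Set Implicit Arguments.
Unset Strict Implicit.
Unset Printing Implicit Defensive.

Record sgraph := SGraph {
  vertex :> finType;
  adj : rel vertex;
  adj_sym : symmetric adj;
  adj_irr : irreflexive adj }.

Definition complete_bipartite_adj (m n : nat) : rel ('I_m + 'I_n) :=
  fun x y => match x, y with
             | inl _, inr _ | inr _, inl _ => true
             | _, _ => false
             end.

Lemma complete_bipartite_sym m n : symmetric (@complete_bipartite_adj m n).
Proof. by case=> [?|?] [?|?]. Qed.

Lemma complete_bipartite_irr m n : irreflexive (@complete_bipartite_adj m n).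
Proof. by case. Qed.

Definition complete_bipartite (m n : nat) : sgraph :=
  SGraph (@complete_bipartite_sym m n) (@complete_bipartite_irr m n).

Local Open Scope nat_scope.
Local Open Scope fset_scope.

Section Square.
Variable G : sgraph.

Definition has_path (u v : G) (k : nat) : bool :=
  [exists p : k.-tuple G,
    [&& path (@adj G) u p, last u p == v & uniq (u :: p)]].

(* Length of a shortest path. Paths have fewer than #|G| edges, so the value is
   the junk #|G| exactly when u and v lie in different components; this is why
   square_adj below also requires connectedness. *)
Definition dist (u v : G) : nat := find (has_path u v) (iota 0 #|G|).

Definition square_adj : rel G :=
  fun u v => [&& u != v, connect (@adj G) u v & dist u v <= 2].

Lemma has_path_sym u v k : has_path u v k = has_path v u k.
Proof.
suff imp x y : has_path x y k -> has_path y x k by apply/idP/idP; apply: imp.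
case/existsP=> p /and3P[xp /eqP lp Up]; apply/existsP.
have sz : size (rev (belast x p)) == k by rewrite size_rev size_belast size_tuple.
exists (Tuple sz); rewrite /= -{1 2 3}lp; apply/and3P; split.
- by rewrite rev_path; apply: sub_path xp => a b; rewrite adj_sym.
- by case: (tval p) => //= a s; rewrite rev_cons last_rcons.
- by rewrite -/(uniq (last x p :: rev (belast x p))) -rev_rcons -lastI rev_uniq.
Qed.

Lemma dist_sym u v : dist u v = dist v u.
Proof. by apply: eq_find => k; apply: has_path_sym. Qed.

Lemma square_sym : symmetric square_adj.
Proof.
move=> u v; rewrite /square_adj eq_sym dist_sym.
by rewrite (sym_connect_sym (@adj_sym G)).
Qed.

Lemma square_irr : irreflexive square_adj.
Proof. by move=> u; rewrite /square_adj eqxx. Qed.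

Definition square : sgraph := SGraph square_sym square_irr.

End Square.

Definition sumset (A B : {fset nat}) : {fset nat} :=
  [fset (a + b)%N | a in A, b in B]%fset.

(* Set-labels are finite: the notion of mono-indexed element and the weakness
   condition compare cardinalities as natural numbers. For infinite A and B,
   |A + B| = max(|A|, |B|) always holds, and the theory would degenerate. *)
Section Labelling.
Variables (G : sgraph) (f : G -> {fset nat}).

(* Integer additive set-indexer. The edge labelling sumset (f u) (f v) is injective
   on edges, an edge being the unordered pair [set u; v]. *)
Definition is_iasi : Prop :=
  [/\ injective f,
      forall v, f v <> fset0 &
      forall u v x y, adj u v -> adj x y ->
        sumset (f u) (f v) = sumset (f x) (f y) -> [set u; v] = [set x; y]].

Definition is_weak_iasi : Prop :=
  is_iasi /\
  forall u v, adj u v ->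
    #|`sumset (f u) (f v)| = maxn #|`f u| #|`f v|.

Definition mono_indexed_edges : {set {set G}} :=
  [set [set u; v] | u in G, v in G & adj u v && (#|`sumset (f u) (f v)| == 1)].

End Labelling.

Definition is_sparing_number (G : sgraph) (k : nat) : Prop :=
  (exists2 f : G -> {fset nat}, is_weak_iasi f & #|mono_indexed_edges f| = k) /\
  (forall f : G -> {fset nat}, is_weak_iasi f -> k <= #|mono_indexed_edges f|).

(* Main.v *)
(* Any two vertices of K_{m,n} are at distance at most 2, so its square is the
   complete graph on m + n vertices. If |A|, |B| >= 2 then |A + B| > max(|A|, |B|),
   so in a weak IASI of a complete graph at most one vertex is not mono-indexed;
   since the mono-indexed edges are exactly the pairs of mono-indexed vertices,
   there are at least C(m + n - 1, 2) of them. Equality is attained by labels with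
   minima 2^0, 2^1, 2^2, ..., all singletons but the first: a sum 2^i + 2^j with
   i <> j determines {i, j}. *)
Require Import Defs.
From mathcomp Require Import all_boot.
From mathcomp Require Import finmap zify.

Set Implicit Arguments.
Unset Strict Implicit.
Unset Printing Implicit Defensive.

(** * Cardinalities of sumsets *)

Lemma mem_sumset (A B : {fset nat}) a b :
  a \in A -> b \in B -> a + b \in sumset A B.
Proof. by move=> Aa Bb; apply/imfset2P; exists a => //; exists b. Qed.

Lemma sumsetP (A B : {fset nat}) x :
  reflect (exists a b, [/\ a \in A, b \in B & x = a + b]) (x \in sumset A B).
Proof.
apply: (iffP idP) => [/imfset2P[a Aa [b Bb ->]]|[a [b [Aa Bb ->]]]].
  by exists a, b.
exact: mem_sumset.
Qed.

Lemma sumsetC (A B : {fset nat}) : sumset A B = sumset B A.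
Proof.
by apply/fsetP=> x; apply/sumsetP/sumsetP=> -[a [b [? ? ->]]];
  exists b, a; rewrite addnC.
Qed.

Lemma sumset1r (A : {fset nat}) b :
  sumset A [fset b]%fset = [fset (a + b)%N | a in A]%fset.
Proof.
apply/fsetP=> x; apply/sumsetP/imfsetP => [[a [c [Aa /fset1P-> ->]]]|[a Aa ->]].
  by exists a.
by exists a, b; rewrite fset11.
Qed.

Lemma card_sumset1r (A : {fset nat}) b : #|` sumset A [fset b]%fset| = #|` A|.
Proof. by rewrite sumset1r card_imfset //; apply: addIn. Qed.

Lemma fset_nat_max (A : {fset nat}) :
  A != fset0 -> exists2 x, x \in A & forall y, y \in A -> y <= x.
Proof.
move=> /fset0Pn exA.
have bound y : y \in A -> y <= \max_(z <- A) z by move=> Ay; apply: leq_bigmax_seq.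
by case: (ex_maxnP exA bound) => x; exists x.
Qed.

Lemma fset_nat_pair (B : {fset nat}) :
  1 < #|` B| -> exists b c, [/\ b \in B, c \in B & b < c].
Proof.
move=> B2; have /fset0Pn[b Bb] : B != fset0 by rewrite -cardfs_gt0 ltnW.
have /fset0Pn[c] : (B `\ b)%fset != fset0.
  by rewrite -cardfs_gt0; move: B2; rewrite (cardfsD1 b B) Bb.
rewrite in_fsetD1 neq_ltn => /andP[/orP[cb|bc] Bc]; first by exists c, b.
by exists b, c.
Qed.

(* Besides the translate A + b, the sumset contains max A + c, where b < c in B. *)
Lemma ltn_card_sumset (A B : {fset nat}) :
  A != fset0 -> 1 < #|` B| -> #|` A| < #|` sumset A B|.
Proof.
move=> /fset_nat_max[x Ax xmax] /fset_nat_pair[b [c [Bb Bc bc]]].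
rewrite -(card_sumset1r A b); apply: fproper_ltn_card; rewrite fproperE.
apply/andP; split; apply/fsubsetP.
  by move=> y /sumsetP[a [_ [Aa /fset1P-> ->]]]; apply: mem_sumset.
move=> /(_ (x + c) (mem_sumset Ax Bc)) /sumsetP[a [_ [/xmax ax /fset1P->]]].
lia.
Qed.

(** The larger exponents must agree: if [j < l], then [2 ^ i + 2 ^ j < 2 ^ j.+1 <= 2 ^ l], so the
    right-hand sum is strictly larger. The equal terms then cancel. *)
Lemma expn2_add_inj i j k l : i < j -> k < l ->
  2 ^ i + 2 ^ j = 2 ^ k + 2 ^ l -> i = k /\ j = l.
Proof.
have top a b c d : a < b -> b < d -> 2 ^ a + 2 ^ b < 2 ^ c + 2 ^ d.
  move=> ab bd; have: 2 ^ a < 2 ^ b by rewrite ltn_exp2l.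
  have: 2 ^ b.+1 <= 2 ^ d by rewrite leq_exp2l.
  by rewrite expnS; lia.
move=> ij kl e; have jl : j = l.
  case: (ltngtP j l) => // h; first by have := top _ _ k _ ij h; lia.
  by have := top _ _ i _ kl h; lia.
by split=> //; apply/(@expnI 2) => //; move: e; rewrite jl; lia.
Qed.

(** * Weak labellings of complete graphs *)

Section CompleteGraph.
Variable G : sgraph.
Hypothesis complete : forall u v : G, adj u v = (u != v).

Definition mono_vertices (f : G -> {fset nat}) : {set G} :=
  [set v | #|` f v| == 1].

(** Labels are non-empty, so the maximum of two label sizes is 1 exactly when both sizes are 1. *)
Lemma mono_indexed_edgesE (f : G -> {fset nat}) : is_weak_iasi f ->
  mono_indexed_edges f =
    [set B : {set G} | B \subset mono_vertices f & #|B| == 2].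
Proof.
move=> [[_ f0 _] fw]; have f_gt0 v : 0 < #|` f v|.
  by rewrite cardfs_gt0; apply/eqP; apply: f0.
have edge u v : u != v ->
    (#|` sumset (f u) (f v)| == 1) = ([set u; v] \subset mono_vertices f).
  move=> uv; rewrite fw ?complete // subUset !sub1set !inE.
  by have := f_gt0 u; have := f_gt0 v; lia.
apply/setP=> B; rewrite inE; apply/imset2P/andP.
  case=> u v _; rewrite inE complete => /andP[_ /andP[uv uv1]] ->.
  by rewrite -edge // cards2 uv.
case=> sB /cards2P[u [v [uv defB]]]; apply: (Imset2spec (x1 := u) (x2 := v)) => //.
by rewrite inE complete uv edge // -defB.
Qed.

Lemma card_mono_indexed_edges (f : G -> {fset nat}) : is_weak_iasi f ->
  #|mono_indexed_edges f| = 'C(#|mono_vertices f|, 2).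
Proof. by move=> /mono_indexed_edgesE->; apply: cards_draws. Qed.

(** Two distinct vertices with non-singleton labels would be adjacent, and their sumset would be
    strictly larger than either label, against weakness. *)
Lemma card_mono_vertices (f : G -> {fset nat}) : is_weak_iasi f ->
  #|G|.-1 <= #|mono_vertices f|.
Proof.
move=> [[_ f0 _] fw]; suff: #|~: mono_vertices f| <= 1.
  by have := cardsC (mono_vertices f); lia.
apply/card_le1P=> u; rewrite !inE => u1 v; rewrite !inE.
apply/idP/eqP=> [v1|-> //]; apply/eqP; apply/contraT => vu.
have nz w : f w != fset0 by apply/eqP.
have big w : #|` f w| != 1 -> 1 < #|` f w|.
  by move: (nz w); rewrite -cardfs_gt0; lia.
have := ltn_card_sumset (nz u) (big v v1).
have := ltn_card_sumset (nz v) (big u u1).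
by rewrite sumsetC fw ?complete 1?eq_sym //; lia.
Qed.

(** Rank 0 receives [{1, 2}]. For any other rank the boolean summand is 0, so the two listed
    elements coincide. *)
Definition binary_label (v : G) : {fset nat} :=
  let i := enum_rank v : nat in [fset 2 ^ i; (2 ^ i + (i == 0))%N]%fset.

Lemma mem_binary_label v : 2 ^ enum_rank v \in binary_label v.
Proof. by rewrite !inE eqxx. Qed.

Lemma binary_label_ge v x : x \in binary_label v -> 2 ^ enum_rank v <= x.
Proof. by rewrite !inE => /orP[]/eqP->; rewrite ?leq_addr. Qed.

Lemma binary_label1 v :
  enum_rank v != 0 :> nat -> binary_label v = [fset 2 ^ enum_rank v]%fset.
Proof. by rewrite /binary_label => /negPf->; rewrite addn0 fsetUid. Qed.

Lemma card_binary_label v : #|` binary_label v| = (enum_rank v == 0 :> nat).+1.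
Proof. by rewrite cardfs2; case: (_ == 0); rewrite ?addn0 ?eqxx //; lia. Qed.

Lemma binary_label_inj : injective binary_label.
Proof.
move=> u v e; apply/enum_rank_inj/val_inj/(@expnI 2) => //=.
apply/eqP; rewrite eqn_leq; apply/andP; split; apply: binary_label_ge.
  by rewrite e mem_binary_label.
by rewrite -e mem_binary_label.
Qed.

Lemma binary_label_sum_ge u v x : x \in sumset (binary_label u) (binary_label v) ->
  2 ^ enum_rank u + 2 ^ enum_rank v <= x.
Proof.
by case/sumsetP=> a [b [/binary_label_ge ? /binary_label_ge ? ->]]; apply: leq_add.
Qed.

(** Equal sumsets have equal minima, and each minimum is a sum of two powers of 2 whose exponents
    are the distinct ranks of the endpoints. *)
Lemma binary_label_sum_inj u v x y : u != v -> x != y ->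
  sumset (binary_label u) (binary_label v) =
  sumset (binary_label x) (binary_label y) -> [set u; v] = [set x; y].
Proof.
move=> uv xy e; have rank_neq (a b : G) : a != b ->
    enum_rank a != enum_rank b :> nat.
  by apply: contraNneq => /val_inj/enum_rank_inj->.
have rank_eq (a b : G) : enum_rank a = enum_rank b :> nat -> a = b.
  by move=> ab; apply/enum_rank_inj/val_inj.
have {e} : 2 ^ enum_rank u + 2 ^ enum_rank v = 2 ^ enum_rank x + 2 ^ enum_rank y.
  apply/eqP; rewrite eqn_leq; apply/andP; split; apply: binary_label_sum_ge.
    by rewrite e mem_sumset ?mem_binary_label.
  by rewrite -e mem_sumset ?mem_binary_label.
(* Sums and unordered pairs are symmetric, so each pair may be sorted by rank, as [expn2_add_inj]
   requires. *)
wlog uv_lt : u v uv / enum_rank u < enum_rank v.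
  have := rank_neq _ _ uv; rewrite neq_ltn => /orP[] lt_ hw; first exact: hw.
  by rewrite addnC [[set u; v]]setUC; apply: hw; rewrite 1?eq_sym.
wlog xy_lt : x y xy / enum_rank x < enum_rank y.
  have := rank_neq _ _ xy; rewrite neq_ltn => /orP[] lt_ hw; first exact: hw.
  by rewrite (addnC (2 ^ enum_rank x)) [[set x; y]]setUC; apply: hw; rewrite 1?eq_sym.
by case/(expn2_add_inj uv_lt xy_lt) => /rank_eq-> /rank_eq->.
Qed.

Lemma binary_label_weak_iasi : is_weak_iasi binary_label.
Proof.
split; first split.
- exact: binary_label_inj.
- by move=> v e; have := mem_binary_label v; rewrite e inE.
- by move=> u v x y; rewrite !complete; apply: binary_label_sum_inj.
move=> u v; rewrite complete => uv.
have card_gt0 w : 0 < #|` binary_label w| by rewrite card_binary_label.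
(* At most one endpoint has rank 0. The other has a singleton label, so the sumset is a
   translate. *)
case: (eqVneq (enum_rank v : nat) 0) => [v0|/binary_label1 ->].
  have u0 : enum_rank u != 0 :> nat.
    by rewrite -v0; apply: contraNneq uv => /val_inj/enum_rank_inj->.
  by rewrite (binary_label1 u0) sumsetC card_sumset1r cardfs1; apply/esym/maxn_idPr.
by rewrite card_sumset1r cardfs1; apply/esym/maxn_idPl.
Qed.

Lemma card_mono_vertices_binary_label :
  0 < #|G| -> #|mono_vertices binary_label| = #|G|.-1.
Proof.
move=> G0; pose v0 : G := enum_val (Ordinal G0).
rewrite -(cardsC1 v0); apply: eq_card => v; rewrite !inE card_binary_label eqSS eqb0.
by rewrite -(inj_eq enum_rank_inj) enum_valK.
Qed.

Lemma complete_sparing_number : 0 < #|G| -> is_sparing_number G 'C(#|G|.-1, 2).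
Proof.
move=> G0; split=> [|f fw].
  exists binary_label; first exact: binary_label_weak_iasi.
  by rewrite card_mono_indexed_edges ?card_mono_vertices_binary_label //;
    apply: binary_label_weak_iasi.
by rewrite card_mono_indexed_edges // leq_bin2l // card_mono_vertices.
Qed.

End CompleteGraph.

(** * The square of a complete bipartite graph *)

Lemma dist_le (G : sgraph) (u v : G) k : has_path u v k -> dist u v <= k.
Proof.
(* [dist] searches only lengths below [#|G|]; the path has [k + 1] distinct vertices, which keeps
   [k] in that range. *)
move=> uvk; have k_lt : k < #|G|.
  case/existsP: uvk => p /and3P[_ _ /card_uniqP].
  by rewrite /= size_tuple => <-; apply: max_card.
rewrite leqNgt; apply/negP=> /(before_find 0).
by rewrite nth_iota // uvk.
Qed.

Lemma square_adj_path (G : sgraph) (u v : G) (p : seq G) :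
  path (@adj G) u p -> last u p = v -> uniq (u :: p) -> 0 < size p <= 2 ->
  square_adj u v.
Proof.
move=> up lp Up /andP[p_gt0 p_le2]; apply/and3P; split.
- case: p p_gt0 lp Up {up p_le2} => // x p _ <- /= /andP[+ _].
  by apply: contraNneq => ->; apply: mem_last.
- by apply/connectP; exists p.
apply: leq_trans p_le2; apply: dist_le; apply/existsP; exists (in_tuple p).
by rewrite /= up lp eqxx.
Qed.

Lemma square_complete_bipartite m n (hm : 0 < m) (hn : 0 < n)
  (u v : square (complete_bipartite m n)) : adj u v = (u != v).
Proof.
apply/idP/idP=> [/and3P[] //|].
case: u v => [i|i] [j|j] uv.
(* Two vertices on the same side are joined through a vertex of the other side, which exists because
   [m] and [n] are positive. *)
- by apply: (@square_adj_path (complete_bipartite m n) _ _ [:: inr (Ordinal hn); inl j]); rewrite //= !inE ?negb_or ?andbT.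
- by apply: (@square_adj_path (complete_bipartite m n) _ _ [:: inr j]); rewrite //= !inE ?negb_or ?andbT.
- by apply: (@square_adj_path (complete_bipartite m n) _ _ [:: inl j]); rewrite //= !inE ?negb_or ?andbT.
- by apply: (@square_adj_path (complete_bipartite m n) _ _ [:: inl (Ordinal hm); inr j]); rewrite //= !inE ?negb_or ?andbT.
Qed.

Theorem theorem2p3 (m n : nat) (hm : 0 < m) (hn : 0 < n) :
  is_sparing_number (square (complete_bipartite m n))
    (((m + n - 1) * (m + n - 2)) %/ 2).
Proof.
have cardG : #|square (complete_bipartite m n)| = m + n.
  by rewrite card_sum !card_ord.
have := complete_sparing_number (square_complete_bipartite hm hn).
rewrite cardG bin2 divn2 subn1 subn2; apply; lia.
Qed.
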